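(* Let $[a,b]$ be a bounded closed interval and let $A:L^2(a,b)\to L^2(a,b)$ be the integral operator $(Af)(x)=\int_a^b K(x,y)f(y)\,dy$ with a real, symmetric ($K(x,y)=K(y,x)$), square-integrable kernel $K$. Assume $A$ is injective, let $\{\psi_k\}_{k\ge1}$ be an orthonormal basis of $L^2(a,b)$ of eigenfunctions of $A$ with eigenvalues $\lambda_1>\lambda_2>\lambda_3>\cdots$, $\lambda_k\to0$. Let $\xi$ be a zero-mean Gaussian weak random variable in $L^2(a,b)$ with covariance operator $R_{\xi\xi}$, and for each $\epsilon>0$ let $\zeta=\zeta^{(\epsilon)}$ be a zero-mean Gaussian weak random variable uncorrelated with $\xi$ ($R_{\xi\zeta}=0$) and with covariance operator $R_{\zeta\zeta}=\epsilon^2N$, where $N$ is a fixed positive operator (independent of $\epsilon$) such that $R_{\zeta\zeta}^{-1}$ exists. Put $\eta=A\xi+\zeta$, $\rho_k^2=(R_{\xi\xi}\psi_k,\psi_k)$, $\nu_k^2=(N\psi_k,\psi_k)>0$ (no assumption is made that the components $(\xi,\psi_k)$, or $(\zeta,\psi_k)$, are mutually uncorrelated), and $$\mathcal I_\epsilon=\{k:\lambda_k\rho_k\ge\epsilon\nu_k\},\qquad \widehat B_\epsilon g=\sum_{k\in\mathcal I_\epsilon}\frac{(g,\psi_k)}{\lambda_k}\psi_k .$$ If $R_{\xi\xi}$ is of trace class and the set $\mathcal I_\epsilon$ is finite for every $\epsilon>0$, then $$\lim_{\epsilon\to0}\mathrm{E}\left\{\|\xi-\widehat B_\epsilon\eta\|^2\right\}=0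 .$$
   Context: A (Gaussian) weak random variable in the Hilbert space $L^2(a,b)$ is a linear map $v\mapsto(\xi,v)$ assigning to each $v\in L^2(a,b)$ a real (jointly Gaussian) random variable; it is determined by its mean element and its covariance operator $R_{\xi\xi}$, defined by $(R_{\xi\xi}u,v)=\mathrm{E}\{(\xi,u)(\xi,v)\}$ (zero mean case); $R_{\xi\zeta}$ is defined analogously with $\mathrm{E}\{(\xi,u)(\zeta,v)\}$. $(\cdot,\cdot)$ and $\|\cdot\|$ denote the inner product and norm of $L^2(a,b)$, and $\mathrm{E}$ denotes expectation. *)

(* Defs.v *)
From HB Require Import structures.
From mathcomp Require Import all_boot all_order all_algebra.
From mathcomp Require Import all_classical all_reals all_analysis.
Set Implicit Arguments. Unset Strict Implicit. Unset Printing Implicit Defensive.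
Import Order.TTheory GRing.Theory Num.Theory.
Local Open Scope classical_set_scope.
Local Open Scope ring_scope.

Section L2_defs.
Context {R : realType}.
Local Notation mu := (@lebesgue_measure R).
Variables (a b : R).

Definition L2 (f : R -> R) : Prop :=
  measurable_fun `[a, b] f /\
  (\int[mu]_(x in `[a, b]) ((f x) ^+ 2)%:E < +oo)%E.

Definition ip (f g : R -> R) : R := Rintegral mu `[a, b] (fun x => f x * g x).
Definition sqnorm (f : R -> R) : R := ip f f.

(** equality in L^2(a,b) (i.e. a.e. on [a,b]) *)
Definition L2eq (f g : R -> R) : Prop := sqnorm (fun x => f x - g x) = 0.

Definition L2op (T : (R -> R) -> (R -> R)) : Prop := forall f, L2 f -> L2 (T f).

Definition L2injective (T : (R -> R) -> (R -> R)) : Prop :=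
  forall f, L2 f -> L2eq (T f) (fun=> 0) -> L2eq f (fun=> 0).

Definition positive_op (T : (R -> R) -> (R -> R)) : Prop :=
  forall f, L2 f -> 0 <= ip (T f) f.

Definition orthonormal (e : nat -> R -> R) : Prop :=
  (forall k, L2 (e k)) /\ (forall i j, ip (e i) (e j) = (i == j)%:R).

Definition onbasis (e : nat -> R -> R) : Prop :=
  orthonormal e /\
  forall f, L2 f ->
    (fun n => sqnorm (fun x => f x - \sum_(k < n) ip f (e k) * e k x))
      @ \oo --> 0.

Definition sq_int_kernel (K : R -> R -> R) : Prop :=
  measurable_fun (`[a, b] `*` `[a, b]) (fun z : R * R => K z.1 z.2) /\
  (\int[mu \x mu]_(z in `[a, b] `*` `[a, b]) ((K z.1 z.2) ^+ 2)%:E < +oo)%E.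

Definition kerop (K : R -> R -> R) (f : R -> R) : R -> R :=
  fun x => Rintegral mu `[a, b] (fun y => K x y * f y).

Definition kerop_adj (K : R -> R -> R) : (R -> R) -> (R -> R) :=
  kerop (fun x y => K y x).

(** trace class, for a positive operator: (T e_k, e_k) summable for an
    orthonormal basis (the sum being basis independent for positive T) *)
Definition trace_class_pos (T : (R -> R) -> (R -> R)) : Prop :=
  exists e, onbasis e /\
    (\sum_(0 <= k <oo) (ip (T (e k)) (e k))%:E < +oo)%E.

Definition Iset (psi : nat -> R -> R) (lam : nat -> R)
  (Rxx N : (R -> R) -> (R -> R)) (eps : R) : set nat :=
  [set k | eps * Num.sqrt (ip (N (psi k)) (psi k))
           <= lam k * Num.sqrt (ip (Rxx (psi k)) (psi k))].

Definition Bhat (psi : nat -> R -> R) (lam : nat -> R) (I : set nat)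
  (g : R -> R) : R -> R :=
  fun x => \sum_(k \in I) (ip g (psi k) / lam k * psi k x).

End L2_defs.

(** a weak random variable in L^2(a,b): v |-> (X, v), a random variable
    on the sample space Omega *)
Definition wrv (R : realType) (Omega : Type) := (R -> R) -> Omega -> R.

Section weak_rv.
Context {R : realType} (d : measure_display) (Omega : measurableType d)
  (P : probability Omega R).
Variables (a b : R).


(** linearity (random variables identified up to P-a.s. equality) *)
Definition weak_linear (X : wrv R Omega) : Prop :=
  forall (f g : R -> R) (al be : R), L2 a b f -> L2 a b g ->
    {ae P, forall w, X (fun x => al * f x + be * g x) w
                     = al * X f w + be * X g w}.

Definition centered_gaussian (Y : Omega -> R) : Prop :=
  measurable_fun setT Y /\
  ({ae P, forall w, Y w = 0} \/
   exists s : R, 0 < s /\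
     forall A : set R, measurable A -> P (Y @^-1` A) = normal_prob 0 s A).

(** zero-mean Gaussian weak random variable: linear, and every
    component (X, v) is centered Gaussian (so finite families of
    components are jointly Gaussian, by linearity) *)
Definition gaussian_wrv (X : wrv R Omega) : Prop :=
  weak_linear X /\ forall f, L2 a b f -> centered_gaussian (X f).

(** C is the (cross-)covariance operator of X and Y (zero-mean case):
    (C u, v) = E{(X,u)(Y,v)} *)
Definition is_cov (X Y : wrv R Omega) (C : (R -> R) -> (R -> R)) : Prop :=
  forall u v, L2 a b u -> L2 a b v ->
    'E_P[fun w => (X u w * Y v w)%R]%E = (ip a b (C u) v)%:E.

(** E ||X||^2 for a weak random variable, computed in the orthonormal
    basis e : sum_k E{(X, e_k)^2} *)
Definition Esqnorm (X : wrv R Omega) (e : nat -> R -> R) : \bar R :=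
  (\sum_(0 <= k <oo) 'E_P[fun w => (X (e k) w) ^+ 2]%R)%E.

End weak_rv.

(* Main.v *)
Require Import Defs.
From HB Require Import structures.
From mathcomp Require Import all_boot all_order all_algebra.
From mathcomp Require Import all_classical all_reals all_analysis.
From mathcomp Require Import measurable_realfun ring lra.
Import Order.TTheory GRing.Theory Num.Theory.
Import numFieldNormedType.Exports.
Local Open Scope classical_set_scope.
Local Open Scope ring_scope.

(** With [Q v = v - sum_(k in I) (v, psi_k) psi_k] and [B] the estimator, the
    eigen-equation gives [err v = xi (Q v) - zeta (B v)], and the two terms are
    uncorrelated, so [E (err v)^2 = (Rxx Q v, Q v) + eps^2 (N B v, B v)].
    Summing over any orthonormal basis, the second part is at most
    [eps^2 sum_(k in I) nu_k^2 / lam_k^2] by Parseval, and the first at most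
    [sum_(k notin I) rho_k^2] by Parseval and lower semicontinuity.  By the
    choice of [I] the total is bounded by
    [sum_k min (rho_k^2, eps^2 nu_k^2 / lam_k^2)], and since [sum_k rho_k^2] is
    finite this tends to 0 by dominated convergence. *)

(** * Square-integrable functions over a general measure *)

Section square_integrable.
Context {R : realType} {d : measure_display} {T : measurableType d}
  (m : {measure set T -> \bar R}) (D : set T) (mD : measurable D).

(** Stated for an arbitrary measure so that it serves twice: with Lebesgue measure on [[a, b]] it
    unfolds to [L2], and with [P] it expresses finite second moments. *)
Definition sqint (f : T -> R) : Prop :=
  measurable_fun D f /\ (\int[m]_(x in D) ((f x) ^+ 2)%:E < +oo)%E.

Lemma sqint_integrable_sqr f : sqint f ->
  m.-integrable D (EFin \o (fun x => f x ^+ 2)).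
Proof.
move=> [mf If]; apply/integrableP; split.
  by apply/measurable_EFinP; exact: measurable_funX.
apply: le_lt_trans If; rewrite le_eqVlt; apply/orP; left; apply/eqP.
by apply: eq_integral => x _ /=; rewrite ger0_norm ?sqr_ge0.
Qed.

(** The product is dominated by [f ^+ 2 + g ^+ 2]. *)
Lemma sqint_integrableM f g : sqint f -> sqint g ->
  m.-integrable D (EFin \o (fun x => f x * g x)).
Proof.
move=> f2 g2.
have fg : m.-integrable D
    ((fun x => (f x ^+ 2)%:E) \+ (fun x => (g x ^+ 2)%:E))%E.
  by apply: integrableD => //; exact: sqint_integrable_sqr.
apply: le_integrable fg => //.
  by apply/measurable_EFinP; apply: measurable_funM; [case: f2|case: g2].
move=> x _ /=; rewrite lee_fin ler_norml.
have := sqr_ge0 (f x + g x); have := sqr_ge0 (f x - g x).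
have := sqr_ge0 (f x); have := sqr_ge0 (g x).
rewrite ger0_norm ?addr_ge0 ?sqr_ge0//.
by move=> *; apply/andP; split; nra.
Qed.

Lemma sqint_lin f g (r s : R) : sqint f -> sqint g ->
  sqint (fun x => r * f x + s * g x).
Proof.
move=> f2 g2.
have mh : measurable_fun D (fun x => r * f x + s * g x).
  by apply: measurable_funD; apply: measurable_funM => //; [case: f2|case: g2].
split => //.
have fg : m.-integrable D ((fun x => (2 * r ^+ 2)%:E * (f x ^+ 2)%:E) \+
    (fun x => (2 * s ^+ 2)%:E * (g x ^+ 2)%:E))%E.
  by apply: integrableD => //; apply: integrableZl => //;
    exact: sqint_integrable_sqr.
have : m.-integrable D (EFin \o (fun x => (r * f x + s * g x) ^+ 2)).
  apply: le_integrable fg => //.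
    by apply/measurable_EFinP; exact: measurable_funX.
  move=> x _ /=; rewrite lee_fin ger0_norm ?sqr_ge0// ger0_norm; last first.
    by apply: addr_ge0; (apply: mulr_ge0; last exact: sqr_ge0);
      (apply: mulr_ge0 => //; exact: sqr_ge0).
  have := sqr_ge0 (r * f x - s * g x); nra.
move=> /integrableP[_]; apply: le_lt_trans.
rewrite le_eqVlt; apply/orP; left; apply/eqP.
by apply: eq_integral => x _ /=; rewrite ger0_norm ?sqr_ge0.
Qed.

End square_integrable.

(** * Inner product of functions in L^2, without passing to classes *)

Section L2_inner_product.
Context {R : realType}.
Local Notation mu := (@lebesgue_measure R).
Variables (a b : R).
Local Notation L2 := (L2 a b).
Local Notation ip := (ip a b).
Local Notation sqnorm := (sqnorm a b).
Implicit Types (f g h : R -> R).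

Let mD : measurable (`[a, b] : set (measurableTypeR R)).
Proof. exact: measurable_itv. Qed.

Lemma L2_lin f g (r s : R) : L2 f -> L2 g -> L2 (fun x => r * f x + s * g x).
Proof. exact: (sqint_lin mu _ mD). Qed.

Lemma L2Z f (r : R) : L2 f -> L2 (fun x => r * f x).
Proof.
move=> f2; have := L2_lin _ _ r 0 f2 f2; congr (Defs.L2 _ _ _).
by apply/funext => x; rewrite mul0r addr0.
Qed.

Lemma L2B f g : L2 f -> L2 g -> L2 (fun x => f x - g x).
Proof.
move=> f2 g2; have := L2_lin _ _ 1 (-1) f2 g2; congr (Defs.L2 _ _ _).
by apply/funext => x; rewrite mul1r mulN1r.
Qed.

Lemma L2_sum n (c : nat -> R) (F : nat -> R -> R) : (forall k, L2 (F k)) ->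
  L2 (fun x => \sum_(k < n) c k * F k x).
Proof.
move=> F2; elim: n => [|n IH].
  have := L2Z _ 0 (F2 0%N); congr (Defs.L2 _ _ _).
  by apply/funext => x; rewrite big_ord0 mul0r.
have := L2_lin _ _ 1 (c n) IH (F2 n); congr (Defs.L2 _ _ _).
by apply/funext => x; rewrite big_ord_recr/= mul1r.
Qed.

Lemma ipC f g : ip f g = ip g f.
Proof. by rewrite /Defs.ip; apply: eq_Rintegral => x _; rewrite mulrC. Qed.

Lemma ip_linl f g h (r s : R) : L2 f -> L2 g -> L2 h ->
  ip (fun x => r * f x + s * g x) h = r * ip f h + s * ip g h.
Proof.
move=> f2 g2 h2; rewrite /Defs.ip.
have fh := sqint_integrableM mu _ mD _ _ f2 h2.
have gh := sqint_integrableM mu _ mD _ _ g2 h2.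
rewrite -RintegralZl// -RintegralZl// -RintegralD//; first last.
- by have := integrableZl mD s gh.
- by have := integrableZl mD r fh.
by apply: eq_Rintegral => x _; rewrite mulrDl !mulrA.
Qed.

Lemma ipZl f h (r : R) : L2 f -> L2 h -> ip (fun x => r * f x) h = r * ip f h.
Proof.
move=> f2 h2; have := ip_linl f f h r 0 f2 f2 h2; rewrite mul0r addr0 => <-.
by congr (Defs.ip _ _ _ _); apply/funext => x; rewrite mul0r addr0.
Qed.

Lemma ipBl f g h : L2 f -> L2 g -> L2 h ->
  ip (fun x => f x - g x) h = ip f h - ip g h.
Proof.
move=> f2 g2 h2; rewrite -[ip f h]mul1r -mulN1r -ip_linl//.
by congr (Defs.ip _ _ _ _); apply/funext => x; rewrite mul1r mulN1r.
Qed.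

Lemma ip_suml n (c : nat -> R) (F : nat -> R -> R) h :
  (forall k, L2 (F k)) -> L2 h ->
  ip (fun x => \sum_(k < n) c k * F k x) h = \sum_(k < n) c k * ip (F k) h.
Proof.
move=> F2 h2; elim: n => [|n IH].
  rewrite big_ord0 -[RHS](mul0r (ip h h)) -ipZl//.
  by congr (Defs.ip _ _ _ _); apply/funext => x; rewrite big_ord0 mul0r.
rewrite big_ord_recr/= -IH -[X in X + _]mul1r -ip_linl//; last exact: L2_sum.
by congr (Defs.ip _ _ _ _); apply/funext => x; rewrite big_ord_recr/= mul1r.
Qed.

Lemma ipBr f g h : L2 f -> L2 g -> L2 h ->
  ip h (fun x => f x - g x) = ip h f - ip h g.
Proof. by move=> *; rewrite ipC ipBl// ![ip _ h]ipC. Qed.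

Lemma ip_sumr n (c : nat -> R) (F : nat -> R -> R) h :
  (forall k, L2 (F k)) -> L2 h ->
  ip h (fun x => \sum_(k < n) c k * F k x) = \sum_(k < n) c k * ip h (F k).
Proof.
by move=> *; rewrite ipC ip_suml//; apply: eq_bigr => k _; rewrite ipC.
Qed.

Lemma sqnorm_ge0 f : 0 <= sqnorm f.
Proof. by apply: Rintegral_ge0 => x _; rewrite -expr2 sqr_ge0. Qed.

Lemma sqnorm_lin f g (r s : R) : L2 f -> L2 g ->
  sqnorm (fun x => r * f x + s * g x) =
  r ^+ 2 * sqnorm f + 2 * r * s * ip f g + s ^+ 2 * sqnorm g.
Proof.
move=> f2 g2; have h2 := L2_lin _ _ r s f2 g2.
rewrite /Defs.sqnorm ip_linl// ![ip _ (fun x => _ + _)]ipC !ip_linl//.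
by rewrite [ip g f]ipC; ring.
Qed.

Lemma ip_cauchy_schwarz f g : L2 f -> L2 g ->
  ip f g ^+ 2 <= sqnorm f * sqnorm g.
Proof.
move=> f2 g2.
have [g0|g0] := eqVneq (sqnorm g) 0.
  have [->|i0] := eqVneq (ip f g) 0; first by rewrite expr0n g0 mulr0.
  (* A null [g] need not be the zero function. If [ip f g] were nonzero, this coefficient would give
     the combination squared norm [- sqnorm f - 2], which is negative. *)
  have := sqnorm_ge0 (fun x => 1 * f x + (- (sqnorm f + 1) / ip f g) * g x).
  by rewrite sqnorm_lin// g0 mulr1 -!mulrA mulVf//; have := sqnorm_ge0 f; lra.
have gp : 0 < sqnorm g by rewrite lt_def g0 sqnorm_ge0.
(* This is [sqnorm g] times the component of [f] orthogonal to [g], scaled to avoid a division. *)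
have := sqnorm_ge0 (fun x => sqnorm g * f x + (- ip f g) * g x).
rewrite sqnorm_lin// => H.
have : 0 <= sqnorm g * (sqnorm f * sqnorm g - ip f g ^+ 2) by nra.
by rewrite pmulr_rge0// subr_ge0.
Qed.

(** Cauchy-Schwarz against the null difference. It lets almost everywhere equal functions be
    exchanged inside inner products. *)
Lemma L2eq_ip f g h : L2 f -> L2 g -> L2 h -> L2eq a b f g -> ip h f = ip h g.
Proof.
move=> f2 g2 h2 fg; have fg2 := L2B _ _ f2 g2.
have := ip_cauchy_schwarz _ _ fg2 h2; rewrite fg mul0r => H.
apply/eqP; rewrite -subr_eq0 -ipBr// ipC -sqrf_eq0 eq_le H sqr_ge0//.
Qed.

Lemma L2_strong_weak_cvg (u : nat -> R -> R) f h :
  (forall n, L2 (u n)) -> L2 f -> L2 h ->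
  (fun n => sqnorm (fun x => f x - u n x)) @ \oo --> 0 ->
  (fun n => ip h (u n)) @ \oo --> ip h f.
Proof.
move=> u2 f2 h2 uf; apply/cvgrPdist_lt => e e0.
(* Adding 1 keeps the divisor positive when [h] is null. *)
have C0 : 0 < sqnorm h + 1 by rewrite ltr_wpDl ?sqnorm_ge0.
have d0 : 0 < e ^+ 2 / (sqnorm h + 1) by rewrite divr_gt0 ?exprn_gt0.
move/cvgrPdist_lt/(_ _ d0) : uf; apply: filterS => n.
rewrite sub0r normrN ger0_norm ?sqnorm_ge0// ltr_pdivlMr// => H.
rewrite -ipBr//.
have := ip_cauchy_schwarz _ _ h2 (L2B _ _ f2 (u2 n)).
have := sqnorm_ge0 (fun x => f x - u n x); have := sqnorm_ge0 h => h0 fu0 CS.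
rewrite -(@ltr_pXn2r _ 2%N)// ?nnegrE ?ltW// -normrX ger0_norm ?sqr_ge0//.
nra.
Qed.

End L2_inner_product.

Lemma cvgn_sum {R : realType} {I : Type} (r : seq I) (u : I -> nat -> R)
    (l : I -> R) : (forall k, u k @ \oo --> l k) ->
  (fun n => \sum_(k <- r) u k n) @ \oo --> \sum_(k <- r) l k.
Proof.
move=> ul; elim: r => [|k r IH].
  by rewrite big_nil; under eq_fun do rewrite big_nil; exact: cvg_cst.
rewrite big_cons; under eq_fun do rewrite big_cons.
by apply: cvgD; first exact: ul.
Qed.

Lemma cvgn_Mcst {R : realType} (u : nat -> R) (c l : R) :
  u @ \oo --> l -> (fun n => c * u n) @ \oo --> c * l.
Proof. by move=> ul; apply: cvgM => //; exact: cvg_cst. Qed.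

(** * Partial traces of symmetric positive forms *)

Section symmetric_forms.
Context {R : realType} (a b : R).
Local Notation L2 := (L2 a b).
Local Notation ip := (ip a b).
Local Notation sqnorm := (sqnorm a b).
Local Notation onbasis := (onbasis a b).
Local Notation orthonormal := (Defs.orthonormal a b).

Lemma onbasis_L2 e k : onbasis e -> L2 (e k).
Proof. by move=> [[]]. Qed.

(** The expansion of [f] in [e] converges to [f] in norm, hence also when paired with [g]. *)
Lemma parseval e f g : onbasis e -> L2 f -> L2 g ->
  (fun n => \sum_(j < n) ip f (e j) * ip g (e j)) @ \oo --> ip f g.
Proof.
move=> be f2 g2; have e2 k := onbasis_L2 _ k be; rewrite ipC.
rewrite (_ : (fun n => _) =
  fun n => ip g (fun x => \sum_(j < n) ip f (e j) * e j x)); last first.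
  by apply/funext => n; rewrite (ip_sumr _ _ _ (fun j => ip f (e j))).
apply: L2_strong_weak_cvg => //; last by case: be => _; exact.
by move=> n; apply: (L2_sum _ _ _ (fun j => ip f (e j))).
Qed.

Variable T : (R -> R) -> R -> R.
Hypothesis T2 : L2op a b T.
Hypothesis Tsym : forall u v, L2 u -> L2 v -> ip (T u) v = ip (T v) u.
Hypothesis Tpos : positive_op a b T.

(** Symmetry stands in for linearity of [T]: it moves [T] off the sum onto each [F k], after which
    the inner product is expanded. *)
Lemma form_sum n (c : nat -> R) (F : nat -> R -> R) :
  (forall k, L2 (F k)) ->
  ip (T (fun x => \sum_(k < n) c k * F k x)) (fun x => \sum_(k < n) c k * F k x)
  = \sum_(k < n) \sum_(l < n) c k * c l * ip (T (F k)) (F l).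
Proof.
move=> F2; have S2 := L2_sum a b n c F F2.
rewrite ip_sumr//; last exact: T2.
apply: eq_bigr => k _; rewrite Tsym// ip_sumr//; last exact: T2.
by rewrite big_distrr/=; apply: eq_bigr => l _; rewrite mulrA.
Qed.

(** Expansion of the form at [u - v], which is nonnegative: the tangent bound of a convex quadratic
    form. *)
Lemma form_polar u v : L2 u -> L2 v ->
  2 * ip (T u) v - ip (T u) u <= ip (T v) v.
Proof.
move=> u2 v2; have w2 := L2B _ _ _ _ u2 v2.
have := Tpos _ w2; rewrite ipBr//; last exact: T2.
rewrite ![ip (T (fun x => _ - _)) _]Tsym// !ipBr//; [|exact: T2..].
by rewrite (Tsym v u)//; lra.
Qed.

(** The operator diagonal in [f] with entries [c], cut at [n]. Indicators as [c] give projections;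
    indicators divided by the eigenvalues give the estimator. *)
Definition spectral_mult (f : nat -> R -> R) (c : nat -> R) n (v : R -> R) :=
  fun x => \sum_(k < n) c k * ip v (f k) * f k x.

Lemma L2_spectral_mult f c n v : orthonormal f ->
  L2 (spectral_mult f c n v).
Proof. by move=> [f2 _]; apply: (L2_sum _ _ _ (fun k => c k * ip v (f k))). Qed.

(** The partial traces increase, so each is at most their limit. Expanding both arguments in [f] and
    applying Parseval in [e] multiplies each entry [ip (T (f k)) (f l)] by [ip (f k) (f l)] in the
    limit. Off-diagonal entries, that is correlations between components, thus disappear. *)
Lemma trace_finite_rank e f c n J : onbasis e -> orthonormal f ->
  \sum_(j < J) ip (T (spectral_mult f c n (e j))) (spectral_mult f c n (e j))
  <= \sum_(k < n) c k ^+ 2 * ip (T (f k)) (f k).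
Proof.
move=> be of_; have e2 k := onbasis_L2 _ k be; have [f2 fo] := of_.
pose s J := \sum_(j < J)
  ip (T (spectral_mult f c n (e j))) (spectral_mult f c n (e j)).
have s_nd : nondecreasing_seq s.
  apply/nondecreasing_seqP => i; rewrite /s big_ord_recr/= lerDl.
  by apply: Tpos; exact: L2_spectral_mult.
have sE i : s i = \sum_(k < n) \sum_(l < n) c k * c l * ip (T (f k)) (f l) *
    \sum_(j < i) ip (f k) (e j) * ip (f l) (e j).
  rewrite /s /spectral_mult; under eq_bigr => j _ do
    rewrite (form_sum n (fun k => c k * ip (e j) (f k)))//.
  rewrite exchange_big/=; apply: eq_bigr => k _.
  rewrite exchange_big/=; apply: eq_bigr => l _.
  rewrite big_distrr/=; apply: eq_bigr => j _.
  by rewrite [ip (f k) _]ipC [ip (f l) _]ipC; ring.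
have s_cvg : s @ \oo --> \sum_(k < n) c k ^+ 2 * ip (T (f k)) (f k).
  rewrite (_ : \sum_(k < n) _ = \sum_(k < n) \sum_(l < n)
      c k * c l * ip (T (f k)) (f l) * ip (f k) (f l)); last first.
    apply: eq_bigr => k _; rewrite (bigD1 k)//= big1 ?addr0.
      by rewrite fo eqxx mulr1 expr2.
    by move=> l lk; rewrite fo eq_sym (inj_eq val_inj) (negbTE lk) mulr0.
  rewrite (funext sE).
  apply: cvgn_sum => k; apply: cvgn_sum => l.
  by apply: cvgn_Mcst; exact: parseval.
have <- := cvg_lim (@Rhausdorff R) s_cvg.
by apply: nondecreasing_cvgn_le => //; apply/cvg_ex; eexists; exact: s_cvg.
Qed.

Definition spectral_compl (f : nat -> R -> R) (chi : pred nat) m (v : R -> R) :=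
  fun x => v x - spectral_mult f (fun k => (chi k)%:R) m v x.

(* With [Qn] the truncations of [Q], the bound [2 (T Q v, Qn v) - (T Q v, Q v)
   <= (T Qn v, Qn v)] and continuity of [(T Q v, _)] give lower semicontinuity
   of the form along [Qn v] even when it is not bounded. *)
Lemma trace_complement e f (chi : pred nat) m C J :
  onbasis e -> onbasis f ->
  (forall k, (m <= k)%N -> ~~ chi k) ->
  (forall n, \sum_(k < n | ~~ chi k) ip (T (f k)) (f k) <= C) ->
  \sum_(j < J) ip (T (spectral_compl f chi m (e j)))
                  (spectral_compl f chi m (e j)) <= C.
Proof.
move=> be bf chim HC; pose Q := spectral_compl f chi m; have e2 k := onbasis_L2 _ k be.
have [of_ fdense] := bf.
have Q2 v : L2 v -> L2 (Q v) by move=> v2; apply: L2B => //; exact: L2_spectral_mult.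
(* [Qn] keeps the indices below [n] outside [chi]; once [n] reaches [m], [Q v - Qn n v] is the
   remainder of the full expansion of [v], which tends to 0. *)
pose Qn n v := spectral_mult f (fun k => (~~ chi k)%:R) n v.
have Qn2 n v : L2 (Qn n v) by exact: L2_spectral_mult.
have QnE n v x : (m <= n)%N ->
    Q v x - Qn n v x = v x - \sum_(k < n) ip v (f k) * f k x.
  move=> mn; rewrite /Q /spectral_compl /Qn /spectral_mult.
  rewrite (big_ord_widen n (fun k => (chi k)%:R * ip v (f k) * f k x))//.
  rewrite big_mkcond/= -addrA -opprD -big_split/=; congr (_ - _).
  apply: eq_bigr => k _; case: ltnP => [_|mk].
    by case: (chi k); rewrite /= ?mul1r ?mul0r ?addr0 ?add0r.
  by rewrite chim// mul1r add0r.
have Qcvg v : L2 v -> (fun n => ip (T (Q v)) (Qn n v)) @ \oo --> ip (T (Q v)) (Q v).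
  move=> v2; apply: L2_strong_weak_cvg => //; [exact: Q2|exact/T2/Q2|].
  apply: cvg_trans (fdense _ v2); apply: near_eq_cvg; near=> n.
  congr (Defs.sqnorm _ _ _); apply/funext => x; rewrite QnE//.
  by near: n; exists m.
have lim : (fun n => \sum_(j < J)
    (2 * ip (T (Q (e j))) (Qn n (e j)) - ip (T (Q (e j))) (Q (e j)))) @ \oo -->
    \sum_(j < J) (2 * ip (T (Q (e j))) (Q (e j)) - ip (T (Q (e j))) (Q (e j))).
  apply: cvgn_sum => j; apply: cvgB; last exact: cvg_cst.
  by apply: cvgn_Mcst; exact: Qcvg.
rewrite (_ : \sum_(j < J) _ = \sum_(j < J)
  (2 * ip (T (Q (e j))) (Q (e j)) - ip (T (Q (e j))) (Q (e j)))); last first.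
  by apply: eq_bigr => j _; ring.
have <- := cvg_lim (@Rhausdorff R) lim.
apply: limr_le; first by apply/cvg_ex; eexists; exact: lim.
apply: nearW => n.
apply: (@le_trans _ _ (\sum_(j < J) ip (T (Qn n (e j))) (Qn n (e j)))).
  by apply: ler_sum => j _; apply: form_polar => //; exact: Q2.
apply: le_trans (trace_finite_rank _ _ _ _ _ be of_) _.
apply: le_trans (HC n); rewrite [leRHS]big_mkcond/=.
by apply: ler_sum => k _; case: (chi k); rewrite /= ?expr1n ?mul1r// expr0n mul0r.
Unshelve. all: by end_near. Qed.

(** With an empty [chi] the complement is the identity. This carries a trace bound from one basis to
    another. *)
Lemma trace_basis_le e f C J : onbasis e -> onbasis f ->
  (forall n, \sum_(k < n) ip (T (f k)) (f k) <= C) ->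
  \sum_(j < J) ip (T (e j)) (e j) <= C.
Proof.
move=> be bf HC.
have := trace_complement e f xpred0 0 C J be bf (fun _ _ => isT) HC.
suff E v : spectral_compl f xpred0 0 v = v by under eq_bigr do rewrite E.
by apply/funext => x; rewrite /spectral_compl /spectral_mult big_ord0 subr0.
Qed.

End symmetric_forms.

(** * Operators with square-integrable kernel *)

Section kernel_operator.
Context {R : realType} (a b : R).
Local Notation mu := (@lebesgue_measure R).
Local Notation L2 := (L2 a b).
Local Notation ip := (ip a b).
Local Notation sqnorm := (sqnorm a b).
Local Notation D := (`[a, b]%classic : set (measurableTypeR R)).
Variable K : R -> R -> R.
Hypothesis K2 : sq_int_kernel a b K.

Let mD : measurable D. Proof. exact: measurable_itv. Qed.

Let mDD : measurable (D `*` D). Proof. exact: measurableX. Qed.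

(** Extension of the kernel by zero, so that Tonelli applies on the whole product space. *)
Let K' := (fun z : measurableTypeR R * measurableTypeR R => K z.1 z.2) \_ (D `*` D).

Let mK' : measurable_fun setT K'.
Proof.
by apply/measurable_restrict => //; rewrite setTI; case: K2.
Qed.

Let K'E x y : D x -> D y -> K' (x, y) = K x y.
Proof. by move=> Dx Dy; rewrite /K' patchE mem_set. Qed.

Let measurable_kernel_section x : D x -> measurable_fun D (K x).
Proof.
move=> Dx; apply: (eq_measurable_fun (fun y => K' (x, y))).
  by move=> y /set_mem Dy; rewrite K'E.
apply: measurable_funTS; exact: measurable_fun_pair2.
Qed.

Let S x := (\int[mu]_y (K' (x, y) ^+ 2)%:E)%E.

Let SE x : D x -> S x = (\int[mu]_(y in D) (K x y ^+ 2)%:E)%E.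
Proof.
move=> Dx; rewrite [RHS]integral_mkcond /S; apply: eq_integral => y _.
rewrite patchE; case: ifPn => [/set_mem Dy|]; first by rewrite K'E.
move=> /negP yD; rewrite /K' patchE memNset ?expr0n// => -[_ /= Dy].
by apply: yD; rewrite inE.
Qed.

Let mK'2 : measurable_fun setT (fun z => (K' z ^+ 2)%:E).
Proof. by apply/measurable_EFinP; exact: measurable_funX. Qed.

Let K'2_ge0 z : (0 <= (K' z ^+ 2)%:E)%E.
Proof. by rewrite lee_fin sqr_ge0. Qed.

Let S_ge0 x : (0 <= S x)%E.
Proof. by apply: integral_ge0 => y _. Qed.

Let mS : measurable_fun setT S.
Proof. exact: (measurable_fun_fubini_tonelli_F _ mK'2 K'2_ge0). Qed.

Let S_fin : (\int[mu]_x S x < +oo)%E.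
Proof.
rewrite -(fubini_tonelli1 _ mK'2 K'2_ge0).
case: K2 => _; rewrite integral_mkcond; apply: le_lt_trans.
rewrite le_eqVlt; apply/orP; left; apply/eqP; apply: eq_integral => z _.
by rewrite /K' !patchE; case: ifPn => //; rewrite expr0n.
Qed.

(** By Tonelli [S] has a finite integral, hence is finite almost everywhere. *)
Lemma kernel_section_L2 : {ae mu, forall x, D x -> L2 (K x)}.
Proof.
have : mu.-integrable setT S.
  apply/integrableP; split => //; apply: le_lt_trans S_fin.
  rewrite le_eqVlt; apply/orP; left; apply/eqP; apply: eq_integral => x _.
  by rewrite gee0_abs.
move=> /(integrable_ae measurableT); apply: filterS => x /(_ I) Sx Dx.
by split; [exact: measurable_kernel_section|rewrite -SE// -ge0_fin_numE].
Qed.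

Lemma L2_sqnormE f : L2 f ->
  (\int[mu]_(x in D) (f x ^+ 2)%:E = (sqnorm f)%:E)%E.
Proof.
move=> [mf f2]; rewrite /Defs.sqnorm /Defs.ip /Rintegral fineK.
  by apply: eq_integral => x _; rewrite expr2.
under eq_integral do rewrite -expr2.
by rewrite ge0_fin_numE//; apply: integral_ge0 => x _; rewrite lee_fin sqr_ge0.
Qed.

Lemma L2_kerop f : L2 f -> L2 (kerop a b K f).
Proof.
move=> f2; have [mf _] := f2.
pose f' := f \_ D.
have mf' : measurable_fun setT f' by apply/measurable_restrict => //; rewrite setTI.
pose G (z : measurableTypeR R * measurableTypeR R) := (K' z * f' z.2)%:E.
have mG : measurable_fun setT G.
  apply/measurable_EFinP; apply: measurable_funM => //.
  by apply: measurableT_comp.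
have keropE x : D x -> kerop a b K f x = fine (\int[mu]_y G (x, y)).
  move=> Dx; rewrite /kerop /Rintegral integral_mkcond; congr fine.
  apply: eq_integral => y _; rewrite patchE /G /f' /= patchE.
  by case: ifPn => [/set_mem Dy|_]; rewrite ?mulr0// K'E.
have mkf : measurable_fun D (kerop a b K f).
  apply: (eq_measurable_fun (fine \o (fun x => \int[mu]_y G (x, y))%E)).
    by move=> x /set_mem Dx /=; rewrite keropE.
  apply: measurable_funTS; apply: measurableT_comp; first exact: fine_measurable.
  (* Tonelli gives measurability in [x] for nonnegative integrands only, hence the split into
     positive and negative parts. *)
  rewrite (_ : (fun x => _) = (fun x => \int[mu]_y (G^\+%E (x, y)) -
      \int[mu]_y (G^\-%E (x, y)))%E); last first.
    by apply/funext => x; rewrite integralE; congr (_ - _)%E;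
      congr integral; apply/funext => y; rewrite ?funeposE ?funenegE.
  apply: emeasurable_funB.
  - apply: (measurable_fun_fubini_tonelli_F G^\+%E) => //.
    exact: measurable_funepos.
  - apply: (measurable_fun_fubini_tonelli_F G^\-%E) => //.
    exact: measurable_funeneg.
split => //.
(* Cauchy-Schwarz on the section [K x]. The summand 1 makes the factor positive, so the right side
   is infinite where [S x] is, and the bound holds there whatever default value the integral
   takes. *)
have bound x : D x -> ((kerop a b K f x ^+ 2)%:E <= (sqnorm f + 1)%:E * S x)%E.
  move=> Dx; have C0 : 0 < sqnorm f + 1 by rewrite ltr_wpDl ?sqnorm_ge0.
  have [Sx|] := boolP (S x \is a fin_num); last first.
    by rewrite ge0_fin_numE// -leNgt leye_eq => /eqP ->; rewrite gt0_muley ?leey.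
  have Kx2 : L2 (K x).
    by split; [exact: measurable_kernel_section|rewrite -SE// -ge0_fin_numE].
  rewrite SE// (L2_sqnormE _ Kx2) -EFinM lee_fin.
  apply: le_trans (ip_cauchy_schwarz _ _ _ _ Kx2 f2) _.
  by have := sqnorm_ge0 a b (K x); nra.
apply: (@le_lt_trans _ _ (\int[mu]_(x in D) ((sqnorm f + 1)%:E * S x))%E).
  apply: ge0_le_integral => //.
  - by move=> x _; rewrite lee_fin sqr_ge0.
  - by apply/measurable_EFinP; exact: measurable_funX.
  - apply: measurable_funTS; apply: measurable_funeM; exact: mS.
rewrite ge0_integralZl//; [|exact: measurable_funTS|by rewrite lee_fin addr_ge0 ?sqnorm_ge0].
apply: lte_mul_pinfty; rewrite ?lee_fin ?addr_ge0 ?sqnorm_ge0//.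
apply: le_lt_trans S_fin; exact: ge0_subset_integral.
Qed.

Lemma L2eqP f g : L2 f -> L2 g ->
  L2eq a b f g <-> {ae mu, forall x, D x -> f x = g x}.
Proof.
move=> f2 g2; have h2 := L2B _ _ _ _ f2 g2.
have mh : measurable_fun D (fun x => ((f x - g x) ^+ 2)%:E).
  by apply/measurable_EFinP; apply: measurable_funX; case: h2.
have h0 : L2eq a b f g <->
    (\int[mu]_(x in D) `|((f x - g x) ^+ 2)%:E| = 0)%E.
  under eq_integral do rewrite gee0_abs ?lee_fin ?sqr_ge0//.
  by rewrite L2_sqnormE// /L2eq; split => [->//|[]].
apply: (iff_trans h0); apply: (iff_trans (ae_eq_integral_abs _ mD mh)).
split; apply: filterS => x /= H Dx.
  by move: (H Dx) => [/eqP]; rewrite sqrf_eq0 subr_eq0 => /eqP.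
by rewrite H// subrr expr0n.
Qed.

(** Off one null set the section [K x] is square integrable and all the countably many
    eigen-equations hold at [x]. There the operator is an inner product with [K x], so it
    distributes over the sum. *)
Lemma kerop_spectral_mult (psi : nat -> R -> R) (lam c : nat -> R) n :
  (forall k, L2 (psi k)) ->
  (forall k, L2eq a b (kerop a b K (psi k)) (fun x => lam k * psi k x)) ->
  L2eq a b (kerop a b K (fun x => \sum_(k < n) c k * psi k x))
    (fun x => \sum_(k < n) c k * lam k * psi k x).
Proof.
move=> psi2 psiK; have S2 := L2_sum a b n c psi psi2.
apply/L2eqP; [exact: L2_kerop|exact: (L2_sum _ _ _ (fun k => c k * lam k))|].
have psi_ae : {ae mu, forall x k, D x -> kerop a b K (psi k) x = lam k * psi k x}.
  apply/ae_foralln => k; apply/L2eqP => //; [exact: L2_kerop|exact: L2Z].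
apply: filterS2 kernel_section_L2 psi_ae => x Kx eig Dx.
rewrite -[LHS]/(ip (K x) _) ip_sumr//; last exact: Kx.
by apply: eq_bigr => k _; rewrite -mulrA -eig.
Qed.

End kernel_operator.

(** * Tails and domination for nonnegative series *)

Section series.
Context {R : realType}.
Implicit Types (t u c : nat -> R) (C : R).

Lemma ler_sum_widen u n p : (forall k, 0 <= u k) -> (n <= p)%N ->
  \sum_(k < n) u k <= \sum_(k < p) u k.
Proof.
move=> u0 np; rewrite (big_ord_widen p u np) big_mkcond.
by apply: ler_sum => k _; case: ifP.
Qed.

(** [M] is an index whose partial sum is within [e] of the supremum of all partial sums. *)
Lemma bounded_series_tail u C : (forall n, \sum_(k < n) u k <= C) ->
  forall e, 0 < e -> exists M, forall n,
    \sum_(k < n) u k <= \sum_(k < M) u k + e.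
Proof.
move=> uC e e0; pose A := range (fun n => \sum_(k < n) u k).
have supA : has_sup A.
  by split; [exists (\sum_(k < 0) u k), 0%N|exists C => _ [n _ <-]].
have [_ [M _ <-] HM] := sup_adherent e0 supA.
exists M => n; apply: (@le_trans _ _ (sup A)); last by move: HM; lra.
by apply: ub_le_sup; [case: supA|exists n].
Qed.

(** Dominated convergence in quantitative form: [c] controls the terms below [M], and the tail of
    [u] controls the others. *)
Lemma dominated_series t u c M (e : R) :
  (forall k, 0 <= t k) -> (forall k, t k <= u k) -> (forall k, t k <= c k) ->
  (forall n, \sum_(k < n) u k <= \sum_(k < M) u k + e) ->
  forall n, \sum_(k < n) t k <= \sum_(k < M) c k + e.
Proof.
move=> t0 tu tc tail n.
apply: le_trans (ler_sum_widen t _ _ t0 (leq_maxl n M)) _.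
have split_at (v : nat -> R) : \sum_(k < maxn n M) v k =
    \sum_(k < M) v k + \sum_(M <= k < maxn n M) v k.
  by rewrite -!(big_mkord xpredT v) -big_cat_nat//= leq_maxr.
have := tail (maxn n M); rewrite !split_at lerD2l => tailM.
apply: lerD; first by apply: ler_sum => k _.
by apply: le_trans tailM; apply: ler_sum => k _.
Qed.

End series.

Lemma finite_set_nat_bounded (A : set nat) : finite_set A ->
  exists m, forall k, A k -> (k < m)%N.
Proof.
move=> fA; exists (\max_(i <- finmap.enum_fset (fset_set A)) i).+1 => k Ak.
by rewrite ltnS; apply: leq_bigmax_seq => //; rewrite in_fset_set// mem_set.
Qed.

(** * Algebra of second moments *)

Section second_moments.
Context {R : realType} {d : measure_display} {Omega : measurableType d}
  (P : probability Omega R).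
Implicit Types (X Y Z : Omega -> R).
Local Notation sqi := (sqint P setT).

(** The shape of [is_cov] at fixed arguments; a real value [c] records that the expectation is
    finite. *)
Definition mixed_moment X Y (c : R) := 'E_P[fun w => (X w * Y w)%R]%E = c%:E.

Lemma mixed_momentC X Y c : mixed_moment X Y c -> mixed_moment Y X c.
Proof.
by rewrite /mixed_moment; under eq_fun do rewrite mulrC.
Qed.

Lemma mixed_moment_sqint X c : measurable_fun setT X -> mixed_moment X X c ->
  sqi X.
Proof.
move=> mX; rewrite /mixed_moment unlock => XX; split => //.
by under eq_integral do rewrite expr2; rewrite XX ltry.
Qed.

Lemma mixed_moment_ge0 X c : mixed_moment X X c -> 0 <= c.
Proof.
rewrite /mixed_moment unlock => XX; rewrite -lee_fin -XX.
by apply: integral_ge0 => w _; rewrite lee_fin -expr2 sqr_ge0.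
Qed.

Lemma mixed_moment_lin X Y Z (r s x y : R) : sqi X -> sqi Y -> sqi Z ->
  mixed_moment X Z x -> mixed_moment Y Z y ->
  mixed_moment (fun w => r * X w + s * Y w) Z (r * x + s * y).
Proof.
move=> X2 Y2 Z2; rewrite /mixed_moment !unlock => XZ YZ.
have iX := sqint_integrableM P _ measurableT _ _ X2 Z2.
have iY := sqint_integrableM P _ measurableT _ _ Y2 Z2.
transitivity (\int[P]_w (r%:E * (X w * Z w)%:E + s%:E * (Y w * Z w)%:E))%E.
  by apply: eq_integral => w _; rewrite mulrDl -!mulrA.
rewrite integralD//; [|exact: integrableZl|exact: integrableZl].
by rewrite !integralZl// XZ YZ.
Qed.

Lemma second_moment_sub X Y (x c y : R) : sqi X -> sqi Y ->
  mixed_moment X X x -> mixed_moment X Y c -> mixed_moment Y Y y ->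
  mixed_moment (fun w => X w - Y w) (fun w => X w - Y w) (x - 2 * c + y).
Proof.
move=> X2 Y2 XX XY YY; have YX := mixed_momentC _ _ _ XY.
have E : (fun w => X w - Y w) = (fun w => 1 * X w + -1 * Y w).
  by apply/funext => w; rewrite mul1r mulN1r.
have D2 := sqint_lin P _ measurableT _ _ 1 (-1) X2 Y2.
have XD := mixed_momentC _ _ _ (mixed_moment_lin _ _ _ 1 (-1) _ _ X2 Y2 X2 XX YX).
have YD := mixed_momentC _ _ _ (mixed_moment_lin _ _ _ 1 (-1) _ _ X2 Y2 Y2 XY YY).
have := mixed_moment_lin _ _ _ 1 (-1) _ _ X2 Y2 D2 XD YD.
by rewrite E; congr mixed_moment; ring.
Qed.

End second_moments.

(** Turns the sum over a finite set into one over [k < m] with indicator coefficients, to which the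
    finite-rank trace bound applies. *)
Lemma Bhat_spectral_mult {R : realType} (a b : R) psi (lam : nat -> R)
    (I : set nat) m v : (forall k, I k -> (k < m)%N) ->
  Bhat a b psi lam I v =
  spectral_mult a b psi (fun k => `[< I k >]%:R / lam k) m v.
Proof.
move=> Im; apply/funext => x; rewrite /Bhat /spectral_mult.
rewrite (fsbig_ord _ m
  (fun k => `[< I k >]%:R / lam k * ip a b v (psi k) * psi k x)).
rewrite -(fsbig_widen I) => [|k /Im//|k [_ nIk]]; last first.
  by rewrite /= asboolF// !mul0r.
apply: eq_fsbigr => k /set_mem Ik.
by rewrite asboolT// mul1r [_ / lam k]mulrC.
Qed.

Lemma is_cov_sym {R : realType} {d : measure_display}
    {Omega : measurableType d} (P : probability Omega R) (a b : R)
    (X : wrv R Omega) C : is_cov P a b X X C ->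
  forall u v, L2 a b u -> L2 a b v -> ip a b (C u) v = ip a b (C v) u.
Proof.
move=> XC u v u2 v2; apply: EFin_inj; rewrite -!XC//.
by under eq_fun do rewrite mulrC.
Qed.

Lemma is_cov_pos {R : realType} {d : measure_display}
    {Omega : measurableType d} (P : probability Omega R) (a b : R)
    (X : wrv R Omega) C : is_cov P a b X X C -> positive_op a b C.
Proof. by move=> XC u u2; exact: (mixed_moment_ge0 _ _ _ (XC u u u2 u2)). Qed.

(** Each term strictly exceeds its successor, which is at least the limit 0. *)
Lemma decreasing_cvg0_gt0 {R : realType} (u : nat -> R) :
  (forall k, u k.+1 < u k) -> u @ \oo --> 0 -> forall k, 0 < u k.
Proof.
move=> ud u0 k; apply: le_lt_trans (ud k).
have ni : nonincreasing_seq u by apply/nonincreasing_seqP => i; exact: ltW.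
have <- := cvg_lim (@Rhausdorff R) u0.
by apply: nonincreasing_cvgn_ge => //; apply/cvg_ex; exists 0.
Qed.

(** * Mean square error of the estimator *)

Section estimation_error.
Context {R : realType} (a b : R) (K : R -> R -> R)
  (psi : nat -> R -> R) (lam : nat -> R)
  (d : measure_display) (Omega : measurableType d) (P : probability Omega R)
  (xi : wrv R Omega) (Rxx N : (R -> R) -> (R -> R)) (zeta : R -> wrv R Omega).
Local Notation L2 := (L2 a b).
Local Notation ip := (ip a b).
Hypothesis K2 : sq_int_kernel a b K.
Hypothesis Ksym : forall x y, K x y = K y x.
Hypothesis bpsi : onbasis a b psi.
Hypothesis eig :
  forall k, L2eq a b (kerop a b K (psi k)) (fun x => lam k * psi k x).
Hypothesis lam_gt0 : forall k, 0 < lam k.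
Hypothesis xiG : gaussian_wrv P a b xi.
Hypothesis Rxx2 : L2op a b Rxx.
Hypothesis xiC : is_cov P a b xi xi Rxx.
Hypothesis N2 : L2op a b N.
Hypothesis Npos : positive_op a b N.
Hypothesis zetaP : forall eps, 0 < eps ->
     [/\ gaussian_wrv P a b (zeta eps),
         is_cov P a b (zeta eps) (zeta eps) (fun f x => eps ^+ 2 * N f x) &
         is_cov P a b xi (zeta eps) (fun _ _ => 0)].
Hypothesis Rtr : trace_class_pos a b Rxx.
Hypothesis Ifin : forall eps, 0 < eps -> finite_set (Iset a b psi lam Rxx N eps).

Let psi2 k : L2 (psi k). Proof. exact: onbasis_L2. Qed.
Let opsi : Defs.orthonormal a b psi. Proof. by case: bpsi. Qed.

Let Rsym := is_cov_sym _ _ _ _ _ xiC.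
Let Rpos := is_cov_pos _ _ _ _ _ xiC.

Let Nsym u v : L2 u -> L2 v -> ip (N u) v = ip (N v) u.
Proof.
(* At noise level 1 the covariance operator is [N] itself, up to a factor [1 ^+ 2]. *)
move=> u2 v2; have [_ zC _] := zetaP 1 ltr01.
by have := is_cov_sym _ _ _ _ _ zC u v u2 v2; rewrite !ipZl ?expr1n ?mul1r//;
  exact: N2.
Qed.

Let I_ eps := Iset a b psi lam Rxx N eps.
Let chi eps : pred nat := fun k => `[< I_ eps k >].
Let rho2 k := ip (Rxx (psi k)) (psi k).
Let nu2 k := ip (N (psi k)) (psi k).
(** The estimator is self-adjoint, so it is applied to the test function [v]; likewise the kernel
    operator acts through its adjoint. *)
Let err (eps : R) : wrv R Omega := fun v w =>
  xi v w - (xi (kerop_adj a b K (Bhat a b psi lam (I_ eps) v)) w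
            + zeta eps (Bhat a b psi lam (I_ eps) v) w).

Let rho2_ge0 k : 0 <= rho2 k. Proof. exact: Rpos. Qed.
Let nu2_ge0 k : 0 <= nu2 k. Proof. exact: Npos. Qed.

(** Squaring is an equivalence since both sides are nonnegative, [lam k] being positive. *)
Lemma IsetP eps k : 0 < eps ->
  I_ eps k <-> eps ^+ 2 * nu2 k <= lam k ^+ 2 * rho2 k.
Proof.
move=> e0; rewrite /I_ /Iset /= -[X in is_true X <-> _](@ler_pXn2r _ 2%N)//.
- by rewrite !exprMn (sqr_sqrtr (nu2_ge0 k)) (sqr_sqrtr (rho2_ge0 k)).
- by rewrite nnegrE mulr_ge0 ?sqrtr_ge0// ltW.
- by rewrite nnegrE mulr_ge0 ?sqrtr_ge0// ltW.
Qed.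

Lemma second_moment_err eps m v : 0 < eps ->
  (forall k, I_ eps k -> (k < m)%N) -> L2 v ->
  let Q := spectral_compl a b psi (chi eps) m in
  let B := spectral_mult a b psi (fun k => (chi eps k)%:R / lam k) m in
  'E_P[fun w => (err eps v w ^+ 2)%R]%E =
  (ip (Rxx (Q v)) (Q v) + eps ^+ 2 * ip (N (B v)) (B v))%:E.
Proof.
move=> e0 Im v2 Q B; have [[_ zG] zC xzC] := zetaP eps e0.
pose y := B v; pose z := kerop a b K y.
pose Pv := spectral_mult a b psi (fun k => (chi eps k)%:R) m v.
have y2 : L2 y by exact: L2_spectral_mult.
have z2 : L2 z by exact: L2_kerop.
have Pv2 : L2 Pv by exact: L2_spectral_mult.
(* The eigenvalues cancel, so [z] is the projection [Pv], but only up to [L2eq]; the exchange is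
   therefore made inside inner products. *)
have zPv h : L2 h -> ip h z = ip h Pv.
  move=> h2; apply: L2eq_ip => //.
  have := kerop_spectral_mult a b K K2 psi lam
    (fun k => (chi eps k)%:R / lam k * ip v (psi k)) m psi2 eig.
  congr (L2eq _ _ _ _); apply/funext => x; apply: eq_bigr => k _.
  by rewrite [X in X * _ = _]mulrAC divfK ?gt_eqF.
have KE : kerop_adj a b K = kerop a b K.
  by rewrite /kerop_adj; congr kerop; do 2 apply/funext => ?; rewrite Ksym.
have errE w : err eps v w = (xi v w - xi z w) - zeta eps y w.
  by rewrite /err (Bhat_spectral_mult _ _ _ _ _ m)// KE opprD addrA.
have xi2 u : L2 u -> sqint P setT (xi u).
  move=> u2; apply: (mixed_moment_sqint _ _ _ _ (xiC _ _ u2 u2)).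
  by case: xiG => _ /(_ _ u2)[].
have zy2 : sqint P setT (zeta eps y).
  by apply: (mixed_moment_sqint _ _ _ _ (zC _ _ y2 y2)); case: (zG _ y2).
have D2 := sqint_lin P _ measurableT _ _ 1 (-1) (xi2 _ v2) (xi2 _ z2).
have DE : (fun w => 1 * xi v w + -1 * xi z w) = (fun w => xi v w - xi z w).
  by apply/funext => w; rewrite mul1r mulN1r.
have DD := second_moment_sub _ _ _ _ _ _ (xi2 _ v2) (xi2 _ z2)
  (xiC _ _ v2 v2) (xiC _ _ v2 z2) (xiC _ _ z2 z2).
have Dy := mixed_moment_lin P _ _ _ 1 (-1) _ _ (xi2 _ v2) (xi2 _ z2) zy2
  (xzC _ _ v2 y2) (xzC _ _ z2 y2).
rewrite DE in D2 Dy.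
have := second_moment_sub _ _ _ _ _ _ D2 zy2 DD Dy (zC _ _ y2 y2).
rewrite /mixed_moment; under eq_fun do rewrite -expr2 -errE.
move=> ->; congr EFin.
have ip0 : ip (fun=> 0) y = 0.
  rewrite (_ : (fun=> 0) = fun x => 0 * y x) ?ipZl ?mul0r//.
  by apply/funext => x; rewrite mul0r.
have Qv2 : L2 (Q v) by exact: L2B.
rewrite ip0 !mulr0 addr0 mulr0 subr0 ipZl//; last exact: N2.
congr (_ + _).
have QE : Q v = fun x => v x - Pv x by [].
transitivity (ip (Rxx (Q v)) v - ip (Rxx (Q v)) Pv); last first.
  by rewrite -ipBr//; exact: Rxx2.
(* Symmetry brings each [z] and [Pv] out of the argument of [Rxx], where [zPv] can replace [z]. *)
rewrite ![ip (Rxx (Q v)) _]Rsym// QE !ipBr//; [|exact: Rxx2..].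
rewrite (zPv (Rxx v))//; last exact: Rxx2.
rewrite (zPv (Rxx z)); last exact: Rxx2.
rewrite (Rsym z Pv)// (zPv (Rxx Pv)); last exact: Rxx2.
by rewrite (Rsym Pv v)//; ring.
Qed.

Lemma sum_second_moment_err_le eps m C e J : 0 < eps -> onbasis a b e ->
  (forall k, I_ eps k -> (k < m)%N) ->
  (forall n, \sum_(k < n) (if chi eps k then eps ^+ 2 * (nu2 k / lam k ^+ 2)
                           else rho2 k) <= C) ->
  (\sum_(j < J) 'E_P[fun w => (err eps (e j) w ^+ 2)%R] <= C%:E)%E.
Proof.
move=> e0 be Im HC; have e2 k := onbasis_L2 a b e k be.
under eq_bigr do rewrite (second_moment_err eps m)//.
rewrite sumEFin lee_fin big_split/= -big_distrr/=.
have Btr := trace_finite_rank a b N N2 Nsym Npos e psi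
  (fun k => (chi eps k)%:R / lam k) m J be opsi.
pose S := \sum_(k < m) ((chi eps k)%:R / lam k) ^+ 2 * nu2 k.
have chim k : (m <= k)%N -> ~~ chi eps k.
  by move=> mk; apply/asboolPn => /Im; rewrite ltnNge mk.
(* The two parts live on disjoint sets of indices, so the complement may use what remains of [C]
   after the noise part [eps ^+ 2 * S]. Both sums are widened to [maxn n m] for comparison with
   [HC]. *)
have QC n : \sum_(k < n | ~~ chi eps k) rho2 k <= C - eps ^+ 2 * S.
  rewrite lerBrDr; apply: le_trans (HC (maxn n m)).
  rewrite big_mkcond/= /S big_distrr/=.
  have w1 := ler_sum_widen (fun k => if ~~ chi eps k then rho2 k else 0) n
    (maxn n m).
  have w2 := ler_sum_widen
    (fun k => eps ^+ 2 * (((chi eps k)%:R / lam k) ^+ 2 * nu2 k)) m (maxn n m).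
  apply: le_trans (lerD (w1 _ (leq_maxl _ _)) (w2 _ (leq_maxr _ _))) _.
  - by move=> k; case: ifP.
  - by move=> k; rewrite mulr_ge0 ?sqr_ge0// mulr_ge0 ?sqr_ge0.
  rewrite -big_split/=; apply: ler_sum => k _; case: (chi eps k) => /=.
    by rewrite add0r expr_div_n expr1n mul1r [nu2 k / _]mulrC.
  by rewrite mul0r expr0n/= mul0r mulr0 addr0.
have Qtr := trace_complement a b Rxx Rxx2 Rsym Rpos e psi (chi eps) m _ J be bpsi
  chim QC.
apply: le_trans (lerD Qtr (ler_wpM2l (sqr_ge0 eps) Btr)) _.
by rewrite -/S subrK.
Qed.

(** The trace is finite in some basis, and the bound is transferred to [psi]. *)
Lemma rho2_summable : exists C, forall n, \sum_(k < n) rho2 k <= C.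
Proof.
have [e [be se]] := Rtr; have e2 k := onbasis_L2 a b e k be.
have q0 k : (0 <= (ip (Rxx (e k)) (e k))%:E)%E by rewrite lee_fin; exact: Rpos.
exists (fine (\sum_(0 <= k <oo) (ip (Rxx (e k)) (e k))%:E)%E) => n.
apply: (trace_basis_le a b Rxx Rxx2 Rsym Rpos psi e) => // p.
rewrite -lee_fin fineK ?ge0_fin_numE//; last exact: nneseries_ge0.
rewrite -sumEFin -(big_mkord xpredT (fun k => (ip (Rxx (e k)) (e k))%:E)).
exact: nneseries_lim_ge.
Qed.

Lemma Esqnorm_err_le e delta : onbasis a b e -> 0 < delta ->
  exists2 C, 0 <= C & forall eps, 0 < eps ->
    (Esqnorm P (err eps) e <= (eps ^+ 2 * C + delta)%:E)%E.
Proof.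
move=> be d0; have [C0 HC0] := rho2_summable.
(* [M] depends on [delta] alone. The cutoff [m] below varies with [eps] but does not enter the
   bound. *)
have [M tail] := bounded_series_tail _ _ HC0 _ d0.
exists (\sum_(k < M) nu2 k / lam k ^+ 2).
  by apply: sumr_ge0 => k _; rewrite divr_ge0 ?sqr_ge0.
move=> eps e0; have [m Im] := finite_set_nat_bounded _ (Ifin _ e0).
have E0 k : (0 <= 'E_P[fun w => (err eps (e k) w ^+ 2)%R])%E.
  by rewrite unlock; apply: integral_ge0 => w _; rewrite lee_fin sqr_ge0.
apply: lime_le; first exact: is_cvg_nneseries.
apply: nearW => J; rewrite big_mkord.
apply: (sum_second_moment_err_le eps m _ e J e0 be Im) => n.
rewrite big_distrr/=; apply: (dominated_series
  (fun k => if chi eps k then eps ^+ 2 * (nu2 k / lam k ^+ 2) else rho2 k) rho2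
  (fun k => eps ^+ 2 * (nu2 k / lam k ^+ 2))) => // k.
(* Nonnegativity, then the bounds by [rho2] and by the noise term: membership in [I_ eps] selects
   the smaller of the two. *)
- by case: ifP => // _; rewrite mulr_ge0 ?sqr_ge0// divr_ge0 ?sqr_ge0.
- case: ifPn => // /asboolP /(IsetP _ _ e0).
  by rewrite mulrA ler_pdivrMr ?exprn_gt0// [rho2 k * _]mulrC.
- case: ifPn => // /asboolPn nI; rewrite mulrA ler_pdivlMr ?exprn_gt0//.
  by rewrite [rho2 k * _]mulrC leNgt; apply/negP => /ltW /(IsetP _ _ e0).
Qed.

Lemma cvg_Esqnorm_err e : onbasis a b e ->
  Esqnorm P (err eps) e @[eps --> 0^'+] --> 0%E.
Proof.
move=> be.
have E0 eps : (0 <= Esqnorm P (err eps) e)%E.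
  apply: nneseries_ge0 => k _ _.
  by rewrite unlock; apply: integral_ge0 => w _; rewrite lee_fin sqr_ge0.
(* Extended real convergence splits into eventual finiteness and convergence of the real parts. *)
apply/fine_cvgP; split.
  have [C _ HC] := Esqnorm_err_le e 1 be ltr01.
  near=> eps; have eps0 : 0 < eps by [].
  by rewrite ge0_fin_numE//; apply: le_lt_trans (HC _ eps0) _; rewrite ltry.
apply/cvgrPdist_le => delta d0; rewrite /=.
have d20 : 0 < delta / 2 by rewrite divr_gt0.
have [C C0 HC] := Esqnorm_err_le e _ be d20.
(* Below 1, [eps ^+ 2 * C] is at most [eps * C]; the second bound makes this less than [delta / 2],
   with [C + 1] in place of [C] in case [C] is 0. *)
have r0 : 0 < Num.min 1 (delta / 2 / (C + 1)).
  by rewrite lt_min ltr01 divr_gt0// ltr_wpDl.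
near=> eps.
have eps0 : 0 < eps by [].
have : eps < Num.min 1 (delta / 2 / (C + 1)) by near: eps; exact: nbhs_right_lt.
rewrite lt_min => /andP[e1]; rewrite ltr_pdivlMr ?ltr_wpDl// => e2.
have F0 : 0 <= fine (Esqnorm P (err eps) e) by rewrite fine_ge0.
rewrite sub0r normrN ger0_norm//.
apply: (@le_trans _ _ (eps ^+ 2 * C + delta / 2)); last first.
  have : eps ^+ 2 * C <= eps * C by rewrite ler_wpM2r// expr2 ger_pMl// ltW.
  lra.
rewrite -lee_fin fineK; first exact: HC.
by rewrite ge0_fin_numE//; apply: le_lt_trans (HC _ eps0) _; rewrite ltry.
Unshelve. all: by end_near. Qed.

End estimation_error.

Theorem theorem2 (R : realType) (a b : R) (K : R -> R -> R)
  (psi : nat -> R -> R) (lam : nat -> R)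
  (d : measure_display) (Omega : measurableType d) (P : probability Omega R)
  (xi : wrv R Omega) (Rxx N : (R -> R) -> (R -> R))
  (zeta : R -> wrv R Omega) :
  a < b ->
  sq_int_kernel a b K ->
  (forall x y, K x y = K y x) ->
  L2injective a b (kerop a b K) ->
  onbasis a b psi ->
  (forall k, L2eq a b (kerop a b K (psi k)) (fun x => lam k * psi k x)) ->
  (forall k, lam k.+1 < lam k) ->
  lam @ \oo --> 0 ->
  gaussian_wrv P a b xi ->
  L2op a b Rxx -> is_cov P a b xi xi Rxx ->
  L2op a b N -> positive_op a b N -> L2injective a b N ->
  (forall k, 0 < ip a b (N (psi k)) (psi k)) ->
  (forall eps, 0 < eps ->
     [/\ gaussian_wrv P a b (zeta eps),
         is_cov P a b (zeta eps) (zeta eps) (fun f x => eps ^+ 2 * N f x) &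
         is_cov P a b xi (zeta eps) (fun _ _ => 0)]) ->
  trace_class_pos a b Rxx ->
  (forall eps, 0 < eps -> finite_set (Iset a b psi lam Rxx N eps)) ->
  let eta (eps : R) : wrv R Omega :=
    fun v w => xi (kerop_adj a b K v) w + zeta eps v w in
  let err (eps : R) : wrv R Omega :=
    fun v w => xi v w - eta eps (Bhat a b psi lam (Iset a b psi lam Rxx N eps) v) w in
  forall e, onbasis a b e ->
    Esqnorm P (err eps) e @[eps --> 0^'+] --> 0%E.
Proof.
move=> _ K2 Ksym _ bpsi eig lam_decr lam0 xiG Rxx2 xiC N2 Npos _ _ zetaP Rtr Ifin.
move=> eta err e be.
exact: (cvg_Esqnorm_err a b K psi lam d Omega P xi Rxx N zeta K2 Ksym bpsi eig
  (decreasing_cvg0_gt0 _ lam_decr lam0) xiG Rxx2 xiC N2 Npos zetaP Rtr Ifin e be).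
Qed.
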